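(* Let $M$ be a root-closed inside factorial monoid with base $Q$. Then $M=\operatorname{Ap}(M,Q)\oplus\langle Q\rangle$, that is, every $x\in M$ can be written as $x=\sum_{q\in Q}\lambda_q q+z$, where $\lambda_q\in\mathbb N$ (all but finitely many zero) and $z\in\operatorname{Ap}(M,Q)$ are uniquely determined.
   Context: All monoids are additive, commutative, cancellative and reduced (the only unit is $0$). $\mathbb N$ denotes the nonnegative integers. For $a,b\in M$, $a\le_M b$ means $b=a+c$ for some $c\in M$. An atom of a monoid is a nonzero element that is not a sum of two nonzero elements of it. A monoid is factorial if every element is a sum of atoms in a unique way up to order. $\langle Q\rangle$ is the submonoid generated by $Q$; $\operatorname{Ap}(M,Q)=M\setminus(Q+M)$. $M=X\oplus Y$ means that every $m\in M$ can be written as $m=x+y$ with unique $x\in X$, $y\in Y$. $M$ is root-closed if $na\le_M nb$ with $a,b\in M$ and $n$ a positive integer implies $a\le_M b$. $M$ is inside factorial if there is a factorial submonoid $S\subseteq M$ such that for each $x\in M\setminus\{0\}$ there is a positive integer $m$ with $mx\in S$; the set of atoms of $S$ is then called a base of $M$. *)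

(* Defs.v *)
From mathcomp Require Import all_boot all_order all_algebra finmap.
From mathcomp Require Import boolp classical_sets.

Set Implicit Arguments.
Unset Strict Implicit.
Unset Printing Implicit Defensive.

Import GRing.Theory.
Local Open Scope ring_scope.
Local Open Scope classical_set_scope.

Definition cancellative (M : nmodType) := forall a b c : M, a + b = a + c -> b = c.

Definition reduced (M : nmodType) := forall a b : M, a + b = 0 -> a = 0.

Definition le_monoid (M : nmodType) (a b : M) := exists c : M, b = a + c.

Definition root_closed (M : nmodType) :=
  forall (n : nat) (a b : M), (0 < n)%N ->
    le_monoid (a *+ n) (b *+ n) -> le_monoid a b.

Definition submonoid (M : nmodType) : set (set M) :=
  [set S | S 0 /\ forall x y, S x -> S y -> S (x + y)].

(* Atoms and factoriality are taken in the submonoid [S], not in [M]. *)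
Definition atoms (M : nmodType) (S : set M) : set M :=
  [set a | [/\ S a, a <> 0 &
     ~ exists x y, [/\ S x, S y, x <> 0, y <> 0 & a = x + y]]].

Definition factorial_submonoid (M : nmodType) (S : set M) :=
  submonoid S /\
  forall x, S x ->
    (exists2 s : seq M, {in s, forall a, atoms S a} & x = \sum_(a <- s) a) /\
    (forall s t : seq M,
       {in s, forall a, atoms S a} -> {in t, forall a, atoms S a} ->
       x = \sum_(a <- s) a -> x = \sum_(a <- t) a -> perm_eq s t).

Definition inside_factorial_with_base (M : nmodType) (Q : set M) :=
  exists S : set M,
    [/\ factorial_submonoid S,
        forall x : M, x <> 0 -> exists2 m : nat, (0 < m)%N & S (x *+ m)
      & Q = atoms S].

Definition Ap (M : nmodType) (Q : set M) : set M :=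
  ~` [set x | exists q m : M, Q q /\ x = q + m].

Definition generated (M : nmodType) (Q : set M) : set M :=
  smallest (@submonoid M) Q.

Definition is_direct_sum (M : nmodType) (X Y : set M) :=
  forall m : M, exists! p : M * M, [/\ X p.1, Y p.2 & m = p.1 + p.2].

(* Main.v *)
Require Import Defs.
From mathcomp Require Import all_boot all_order all_algebra finmap.
From mathcomp Require Import boolp classical_sets.

(** Write an element of [<Q>] as the sum of a finite sequence of elements of
    [Q].  Factoriality of [S] says that such a sequence is unique up to order,
    and every [x] in [M] has a positive multiple [m x] of this form, so each
    [q] in [Q] has a rational valuation on [M]: the multiplicity of [q] in the
    sequence of [m x], divided by [m].

    Root-closedness makes divisibility by [q] visible on this valuation:
    [q <= x] exactly when the valuation of [x] at [q] is at least 1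
    ([base_le_count]).  Hence [Ap Q] is the set of elements all of whose
    valuations are less than 1 ([Ap_count]), and the decomposition
    [x = sum lambda_q q + z] splits every valuation of [x] into its integral
    part [lambda_q] and its fractional part, the valuation of [z].

    For existence ([Ap_decomposition]), the Euclidean quotients by [m] of the
    multiplicities in [m x] give an element [y] of [<Q>] with [m y <= m x],
    so [y <= x] by root-closedness, and the difference [z] has the remainders
    as multiplicities.  Uniqueness ([Ap_decomposition_unique]) is uniqueness of
    Euclidean division by a common multiplier, and then cancellation for [z].
    Sequences up to permutation translate both to elements of [<Q>] and to
    finitely supported families of coefficients. *)

Set Implicit Arguments.
Unset Strict Implicit.
Unset Printing Implicit Defensive.

Import GRing.Theory.
Local Open Scope ring_scope.
Local Open Scope classical_set_scope.

(** * Sequences with prescribed multiplicities *)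

Definition repeat_by (T : eqType) (f : T -> nat) (u : seq T) : seq T :=
  flatten [seq nseq (f q) q | q <- u].

Lemma count_repeat_by (T : eqType) (f : T -> nat) (u : seq T) (q : T) :
  uniq u -> count_mem q (repeat_by f u) = if q \in u then f q else 0%N.
Proof.
elim: u => [//|a u IHu] /= /andP[au uu].
rewrite /repeat_by /= count_cat -/(repeat_by f u) IHu // count_nseq /= inE.
have [->|qa] := eqVneq q a; first by rewrite mul1n (negbTE au) addn0.
by rewrite mul0n.
Qed.

Lemma repeat_by_sub (T : eqType) (f : T -> nat) (u : seq T) :
  {subset repeat_by f u <= u}.
Proof. by move=> q /flatten_mapP[a au /nseqP[-> _]]. Qed.

Lemma sum_nseq (M : nmodType) (n : nat) (q : M) :
  \sum_(a <- nseq n q) a = q *+ n.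
Proof. by rewrite big_nseq iter_addr_0. Qed.

Lemma sum_repeat_by (M : nmodType) (f : M -> nat) (u : seq M) :
  \sum_(a <- repeat_by f u) a = \sum_(q <- u) q *+ f q.
Proof.
by rewrite /repeat_by big_flatten big_map; apply: eq_bigr => q _; rewrite sum_nseq.
Qed.

Definition copies (T : Type) (n : nat) (s : seq T) : seq T := flatten (nseq n s).

Lemma count_copies (T : Type) (p : pred T) n (s : seq T) :
  count p (copies n s) = (n * count p s)%N.
Proof. by rewrite /copies count_flatten map_nseq sumn_nseq mulnC. Qed.

Lemma sum_copies (M : nmodType) n (s : seq M) :
  \sum_(a <- copies n s) a = (\sum_(a <- s) a) *+ n.
Proof. by rewrite /copies big_flatten big_nseq iter_addr_0. Qed.

Lemma copies_sub (T : eqType) n (s : seq T) : {subset copies n s <= s}.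
Proof. by move=> q /flattenP[r /nseqP[-> _]]. Qed.

Lemma count_split (T : eqType) (q : T) (m : nat) (s : seq T) :
  (m <= count_mem q s)%N ->
  exists r, perm_eq s (nseq m q ++ r).
Proof.
elim: m s => [|m IHm] s; first by exists s.
move=> ms; have qs : q \in s by rewrite -has_pred1 has_count (leq_trans _ ms).
have sE := perm_to_rem qs; move: ms.
rewrite (permP sE) /= eqxx add1n ltnS => /IHm[r rE].
by exists r; apply: (perm_trans sE); rewrite /= perm_cons.
Qed.

(** * Bases *)

Definition seq_in (M : nmodType) (Q : set M) (s : seq M) :=
  {in s, forall a, Q a}.

Lemma seq_in_cat (M : nmodType) (Q : set M) (s t : seq M) :
  seq_in Q s -> seq_in Q t -> seq_in Q (s ++ t).
Proof.
by move=> sQ tQ a; rewrite mem_cat => /orP[as_|at_]; [exact: sQ|exact: tQ].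
Qed.

Lemma seq_in_sub (M : nmodType) (Q : set M) (s t : seq M) :
  {subset s <= t} -> seq_in Q t -> seq_in Q s.
Proof. by move=> st tQ a /st; exact: tQ. Qed.

(** Linear independence over the nonnegative integers: the submonoid generated
    by [Q] is free on [Q]. *)
Definition independent (M : nmodType) (Q : set M) :=
  forall s t : seq M, seq_in Q s -> seq_in Q t ->
    \sum_(a <- s) a = \sum_(a <- t) a -> perm_eq s t.

Definition spans_rationally (M : nmodType) (Q : set M) :=
  forall x : M, exists m (s : seq M),
    [/\ (0 < m)%N, seq_in Q s & x *+ m = \sum_(a <- s) a].

Lemma submonoid_sum (M : nmodType) (S : set M) (s : seq M) :
  submonoid S -> seq_in S s -> S (\sum_(a <- s) a).
Proof.
move=> [S0 SD] sS; rewrite big_seq.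
by elim/big_ind: _ => [|x y|a /sS]; [exact: S0|exact: SD|].
Qed.

(** Independence is uniqueness of factorization in [S]; rational spanning
    combines existence of factorizations with the multiples lying in [S].
    The argument sees [S] only through these two properties. *)
Lemma base_independent_spans (M : nmodType) (Q : set M) :
  inside_factorial_with_base Q -> independent Q /\ spans_rationally Q.
Proof.
move=> [S [[subS facS] mulS ->]]; split=> [s t sQ tQ st|x].
  have Ss : S (\sum_(a <- s) a).
    by apply: submonoid_sum => // a /sQ[].
  by have [_] := facS _ Ss; apply.
have [->|/eqP x0] := eqVneq x 0.
  by exists 1%N, [::]; rewrite big_nil mul0rn.
have [m m0 /facS[[s sQ xs] _]] := mulS _ x0.
by exists m, s.
Qed.

(** * Divisibility by base elements *)

(** Passing from [q <= x] to multiplicities needs a multiplier [n] for the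
    quotient [y], since [m y] need not be in the submonoid generated by [Q];
    the inequality is therefore obtained after scaling by [n].  Conversely,
    [m q <= m x] can be divided by [m] by root-closedness. *)
Lemma base_le_count (M : nmodType) (Q : set M) :
  root_closed M -> independent Q -> spans_rationally Q ->
  forall (x q : M) m s, (0 < m)%N -> seq_in Q s ->
    x *+ m = \sum_(a <- s) a -> Q q ->
    le_monoid q x <-> (m <= count_mem q s)%N.
Proof.
move=> rootM indQ spanQ x q m s m0 sQ xs Qq; split=> [[y xE]|/count_split[r sE]].
  have [n [r [n0 rQ yr]]] := spanQ y.
  have /permP/(_ (pred1 q)) : perm_eq (copies n s) (nseq (m * n) q ++ copies m r).
    apply: indQ.
    - exact: seq_in_sub (@copies_sub _ n s) sQ.
    - apply: seq_in_cat; first by move=> a /nseqP[->].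
      exact: seq_in_sub (@copies_sub _ m r) rQ.
    rewrite big_cat /= !sum_copies sum_nseq -xs -yr xE -!mulrnA.
    by rewrite mulrnDl [in y *+ (n * m)]mulnC.
  rewrite count_cat !count_copies count_nseq /= eqxx mul1n => E.
  by rewrite -(leq_pmul2l n0) E mulnC leq_addr.
apply: (rootM m) => //; exists (\sum_(a <- r) a).
by rewrite xs (perm_big _ sE) big_cat /= sum_nseq.
Qed.

Lemma Ap_count (M : nmodType) (Q : set M) :
  root_closed M -> independent Q -> spans_rationally Q ->
  forall (z : M) m s, (0 < m)%N -> seq_in Q s ->
    z *+ m = \sum_(a <- s) a ->
    Ap Q z <-> forall q, (count_mem q s < m)%N.
Proof.
move=> rootM indQ spanQ z m s m0 sQ zs.
have le_count := base_le_count rootM indQ spanQ m0 sQ zs.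
split=> [Apz q|small [q [y [Qq zE]]]].
  rewrite ltnNge; apply/negP => mq; apply: Apz.
  have Qq : Q q by apply: sQ; rewrite -has_pred1 has_count (leq_trans m0).
  by have [y zE] := (le_count _ Qq).2 mq; exists q, y.
have /(le_count _ Qq) : le_monoid q z by exists y.
by rewrite leqNgt small.
Qed.

(** * Existence and uniqueness of the decomposition *)

Lemma Ap_decomposition (M : nmodType) (Q : set M) :
  cancellative M -> root_closed M -> independent Q -> spans_rationally Q ->
  forall x : M, exists t z,
    [/\ seq_in Q t, Ap Q z & x = \sum_(a <- t) a + z].
Proof.
move=> cancM rootM indQ spanQ x.
have [m [s [m0 sQ xs]]] := spanQ x.
pose t := repeat_by (fun q => count_mem q s %/ m)%N (undup s).
pose r := repeat_by (fun q => count_mem q s %% m)%N (undup s).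
have repQ f : seq_in Q (repeat_by f (undup s)).
  by move=> q /repeat_by_sub; rewrite mem_undup; exact: sQ.
have tQ : seq_in Q t by exact: repQ.
have rQ : seq_in Q r by exact: repQ.
have sE : perm_eq s (copies m t ++ r).
  apply/allP => q _ /=; apply/eqP.
  rewrite count_cat count_copies !count_repeat_by ?undup_uniq // mem_undup.
  case: ifPn => [_|/count_memPn -> //]; last by rewrite muln0.
  by rewrite mulnC -divn_eq.
have xmE : x *+ m = (\sum_(a <- t) a) *+ m + \sum_(a <- r) a.
  by rewrite xs (perm_big _ sE) big_cat /= sum_copies.
have [z xE] : le_monoid (\sum_(a <- t) a) x.
  by apply: (rootM m) => //; exists (\sum_(a <- r) a).
exists t, z; split=> //.
have zr : z *+ m = \sum_(a <- r) a.
  by apply: (cancM ((\sum_(a <- t) a) *+ m)); rewrite -xmE xE mulrnDl.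
apply/(Ap_count rootM indQ spanQ m0 rQ zr) => q.
by rewrite count_repeat_by ?undup_uniq //; case: ifP => // _; rewrite ltn_mod.
Qed.

Lemma Ap_decomposition_unique (M : nmodType) (Q : set M) :
  cancellative M -> root_closed M -> independent Q -> spans_rationally Q ->
  forall (t t' : seq M) (z z' : M), seq_in Q t -> seq_in Q t' ->
    Ap Q z -> Ap Q z' ->
    \sum_(a <- t) a + z = \sum_(a <- t') a + z' -> perm_eq t t' /\ z = z'.
Proof.
move=> cancM rootM indQ spanQ t t' z z' tQ t'Q Apz Apz' E.
have [m [r [m0 rQ zr]]] := spanQ z.
have [m' [r' [m'0 r'Q z'r']]] := spanQ z'.
pose N := (m * m')%N.
have N0 : (0 < N)%N by rewrite muln_gt0 m0.
have uQ : seq_in Q (copies m' r) by exact: seq_in_sub (@copies_sub _ _ _) rQ.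
have u'Q : seq_in Q (copies m r') by exact: seq_in_sub (@copies_sub _ _ _) r'Q.
have zu : z *+ N = \sum_(a <- copies m' r) a by rewrite sum_copies -zr -mulrnA.
have z'u' : z' *+ N = \sum_(a <- copies m r') a.
  by rewrite sum_copies -z'r' -mulrnA mulnC.
have u_small := (Ap_count rootM indQ spanQ N0 uQ zu).1 Apz.
have u'_small := (Ap_count rootM indQ spanQ N0 u'Q z'u').1 Apz'.
have /permP NtE : perm_eq (copies N t ++ copies m' r) (copies N t' ++ copies m r').
  apply: indQ.
  - by apply: seq_in_cat => //; exact: seq_in_sub (@copies_sub _ _ _) tQ.
  - by apply: seq_in_cat => //; exact: seq_in_sub (@copies_sub _ _ _) t'Q.
  by rewrite !big_cat /= -zu -z'u' !(sum_copies N) -!mulrnDl E.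
have tt' : perm_eq t t'.
  apply/allP => q _ /=; apply/eqP.
  (* The multiplicities of [N z] and [N z'] are remainders modulo [N]. *)
  have := congr1 (divn^~ N) (NtE (pred1 q)).
  rewrite !count_cat !(count_copies _ N) ![(N * _)%N]mulnC !divnMDl //.
  by rewrite !divn_small ?addn0.
by split=> //; apply: (cancM (\sum_(a <- t) a)); rewrite E (perm_big _ tt').
Qed.

(** * Elements of the generated submonoid and families of coefficients *)

Lemma generatedP (M : nmodType) (Q : set M) (y : M) :
  generated Q y <-> exists2 t, seq_in Q t & y = \sum_(a <- t) a.
Proof.
split=> [|[t tQ ->] S [subS QS]]; last first.
  by apply: submonoid_sum => // a /tQ /QS.
move=> /(_ [set y | exists2 t, seq_in Q t & y = \sum_(a <- t) a]); apply.
split=> [|a Qa]; last first.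
  by exists [:: a]; [move=> b; rewrite inE => /eqP->|rewrite big_seq1].
split=> [|_ _ [s sQ ->] [t tQ ->]]; first by exists [::]; rewrite ?big_nil.
by exists (s ++ t); [exact: seq_in_cat|rewrite big_cat].
Qed.

(** Finitely supported families of coefficients correspond to sequences up to
    permutation, which carries existence and uniqueness of decompositions from
    sequences over to coefficients. *)
Definition fsfun_seq (T : choiceType) (f : {fsfun T -> nat with 0%N}) : seq T :=
  repeat_by f (finsupp f).

Lemma count_fsfun_seq (T : choiceType) (f : {fsfun T -> nat with 0%N}) q :
  count_mem q (fsfun_seq f) = f q.
Proof.
rewrite count_repeat_by ?fset_uniq //.
by case: ifPn => // /fsfun_dflt.
Qed.

Lemma fsfun_seq_perm_inj (T : choiceType) (f g : {fsfun T -> nat with 0%N}) :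
  perm_eq (fsfun_seq f) (fsfun_seq g) -> f = g.
Proof.
by move=> /permP fg; apply/fsfunP => q; rewrite -!count_fsfun_seq fg.
Qed.

Lemma fsfun_seq_surj (T : choiceType) (t : seq T) :
  exists f : {fsfun T -> nat with 0%N}, perm_eq (fsfun_seq f) t.
Proof.
pose A := [fset q in t]%fset; exists [fsfun q in A => count_mem q t].
apply/allP => q _; rewrite /= count_fsfun_seq fsfunE.
have -> : (q \in A) = (q \in t) by rewrite in_fset.
by case: ifPn => // /count_memPn ->.
Qed.

Lemma mem_fsfun_seq (T : choiceType) (f : {fsfun T -> nat with 0%N}) q :
  (q \in fsfun_seq f) = (q \in finsupp f).
Proof. by rewrite -has_pred1 has_count count_fsfun_seq lt0n mem_finsupp. Qed.

Theorem corollary23 (M : nmodType) (Q : set M)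
    (hcanc : cancellative M) (hred : reduced M)
    (hroot : root_closed M) (hbase : inside_factorial_with_base Q) :
  is_direct_sum (Ap Q) (generated Q) /\
  forall x : M, exists! p : {fsfun M -> nat with 0%N} * M,
    [/\ forall q : M, q \in finsupp p.1 -> Q q, Ap Q p.2
      & x = (\sum_(q <- finsupp p.1) q *+ p.1 q) + p.2].
Proof.
have [indQ spanQ] := base_independent_spans hbase.
have decomp := Ap_decomposition hcanc hroot indQ spanQ.
have decomp_unique := Ap_decomposition_unique hcanc hroot indQ spanQ.
split=> x; have [t [z [tQ Apz xE]]] := decomp x.
  exists (z, \sum_(a <- t) a); split=> [|[z' y] /= [Apz' /generatedP[t' t'Q ->] xE']].
    by split=> //=; [apply/generatedP; exists t|rewrite addrC].
  rewrite addrC xE in xE'.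
  by have [tt' ->] := decomp_unique _ _ _ _ tQ t'Q Apz Apz' xE'; rewrite (perm_big _ tt').
have [f ft] := fsfun_seq_surj t.
exists (f, z); split=> [|[g z'] /= [gQ Apz' xE']].
  split=> //= [q|]; last by rewrite -sum_repeat_by (perm_big _ ft).
  by rewrite -mem_fsfun_seq (perm_mem ft); exact: tQ.
rewrite -sum_repeat_by -/(fsfun_seq g) xE in xE'.
have gQ' : seq_in Q (fsfun_seq g) by move=> q; rewrite mem_fsfun_seq; exact: gQ.
have [tg ->] := decomp_unique _ _ _ _ tQ gQ' Apz Apz' xE'.
by rewrite (fsfun_seq_perm_inj (perm_trans ft tg)).
Qed.
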